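(* Fix $\beta\in\mathbb R^s$ and simple connected graphs $G_1=K_2,G_2,\dots,G_s$, and for each $n$ let $\mu_\beta=\mu_\beta^{(n)}$ be the corresponding exponential random graph model on $\{0,1\}^{\mathcal I_n}$. Assume that $\mu_\beta^{(n)}$ satisfies a $\mathfrak d\text{-}\mathrm{LSI}(\sigma^2)$ for all $n$, with $\sigma^2$ independent of $n$. If, under $\mu_\beta^{(n)}$ and as $n\to\infty$, the central limit theorem $$\binom n2^{-1/2}\sum_{e\in\mathcal I_n}(x_e-\mathbb E_{\mu_\beta}x_e)\Rightarrow\mathcal N(0,v^2)$$ holds, then $$\frac{T_3-\mathbb E_{\mu_\beta}T_3}{(n-2)\mu_2\sqrt{\binom n2}}\Rightarrow\mathcal N(0,v^2),$$ where $\Rightarrow$ denotes convergence in distribution.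
   Context: $\mathcal I_n=\{(i,j):1\le i<j\le n\}$; $x\in\{0,1\}^{\mathcal I_n}$ is identified with a simple graph on $\{1,\dots,n\}$. Exponential random graph model: given $\beta=(\beta_1,\dots,\beta_s)\in\mathbb R^s$ and simple connected graphs $G_i=(V_i,E_i)$ with $G_1=K_2$, $\mu_\beta$ is the probability measure on $\{0,1\}^{\mathcal I_n}$ with $\mu_\beta(x)=Z^{-1}\exp\big(n^2\sum_{i=1}^s\beta_in^{-|V_i|}N_{G_i}(x)\big)$, where $N_{G_i}(x)$ is the number of injective maps $V_i\to\{1,\dots,n\}$ sending edges of $G_i$ to edges of $x$. For a probability measure $\mu$ on $\mathcal Y=\mathcal X^{\mathcal I}$ ($\mathcal X,\mathcal I$ finite), $\overline x_i=(x_j)_{j\ne i}$, and $f:\mathcal Y\to\mathbb R$, let $\mathfrak d_if(x)^2=\frac12\iint(f(\overline x_i,y)-f(\overline x_i,y'))^2\,d\mu(y\mid\overline x_i)\,d\mu(y'\mid\overline x_i)$ (where $\mu(\cdot\mid\overline x_i)$ is the conditional law of the $i$-th coordinate given the others) and $|\mathfrak df|^2=\sum_i(\mathfrak d_if)^2$. $\mu$ satisfies a $\mathfrak d\text{-}\mathrm{LSI}(\sigma^2)$ if $\mathrm{Ent}_\mu(f^2)\le2\sigma^2\int|\mathfrak df|^2d\mu$ for all $f:\mathcal Y\to\mathbb R$, where $\mathrm{Ent}_\mu(g)=\mathbb E_\mu g\log g-\mathbb E_\mu g\log\mathbb E_\mu g$. $\mathcal T_n$ is the set of all $3$-element subsets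 $\{e,f,g\}\subset\mathcal I_n$ forming a triangle, $T_3(x)=\sum_{\{e,f,g\}\in\mathcal T_n}x_ex_fx_g$, and $\mu_2=\mu_2^{(n)}=\mathbb E_{\mu_\beta}x_ex_f$ for any two distinct edges $e,f\in\mathcal I_n$ sharing a vertex (by symmetry this does not depend on the choice). *)

(* Defs.v *)
From HB Require Import structures.
From mathcomp Require Import all_boot all_order all_algebra.
From mathcomp Require Import all_classical all_reals all_analysis.

Set Implicit Arguments.
Unset Strict Implicit.
Unset Printing Implicit Defensive.

Import Order.TTheory GRing.Theory Num.Theory.
Import numFieldNormedType.Exports.

Local Open Scope classical_set_scope.
Local Open Scope ring_scope.

Record fdist (R : realType) (T : finType) := FDist {
  fdist_fun :> T -> R;
  fdist_ge0 : forall x, 0 <= fdist_fun x;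
  fdist_sum1 : \sum_(x : T) fdist_fun x = 1 }.

Definition expect (R : realType) (T : finType) (mu : fdist R T)
    (g : T -> R) : R :=
  \sum_(x : T) mu x * g x.

(* [ln 0 = 0], so the convention [0 log 0 = 0] is built in. *)
Definition Ent (R : realType) (T : finType) (mu : fdist R T)
    (g : T -> R) : R :=
  expect mu (fun x => g x * ln (g x)) - expect mu g * ln (expect mu g).

Definition upd (I X : finType) (x : {ffun I -> X}) (i : I) (y : X) :
    {ffun I -> X} :=
  [ffun j => if j == i then y else x j].

(* mu(y | xbar_i).  When the conditioning event is mu-null this is 0 (as
   division by 0 gives 0); such x have mu x = 0 and do not contribute to
   integrals against mu. *)
Definition cond_law (R : realType) (I X : finType)
    (mu : fdist R {ffun I -> X}) (i : I) (x : {ffun I -> X}) (y : X) : R :=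
  mu (upd x i y) / \sum_(z : X) mu (upd x i z).

Definition d_part_sq (R : realType) (I X : finType)
    (mu : fdist R {ffun I -> X}) (f : {ffun I -> X} -> R) (i : I)
    (x : {ffun I -> X}) : R :=
  2^-1 * \sum_(y : X) \sum_(y' : X)
    (f (upd x i y) - f (upd x i y')) ^+ 2
      * cond_law mu i x y * cond_law mu i x y'.

Definition d_grad_sq (R : realType) (I X : finType)
    (mu : fdist R {ffun I -> X}) (f : {ffun I -> X} -> R)
    (x : {ffun I -> X}) : R :=
  \sum_(i : I) d_part_sq mu f i x.

Definition d_LSI (R : realType) (I X : finType)
    (mu : fdist R {ffun I -> X}) (sigma2 : R) : Prop :=
  forall f : {ffun I -> X} -> R,
    Ent mu (fun x => f x ^+ 2) <= 2 * sigma2 * expect mu (d_grad_sq mu f).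

Record sgraph := SGraph {
  vertex :> finType;
  adj : rel vertex;
  adj_sym : symmetric adj;
  adj_irr : irreflexive adj }.

Definition connected_graph (G : sgraph) : Prop :=
  (0 < #|G|)%N /\ forall u v : G, connect (@adj G) u v.

Definition graph_iso (G H : sgraph) : Prop :=
  exists2 f : G -> H, bijective f & forall u v, adj (f u) (f v) = adj u v.

Lemma neq_sym (T : eqType) : symmetric (fun u v : T => u != v).
Proof. by move=> u v; rewrite eq_sym. Qed.

Lemma neq_irr (T : eqType) : irreflexive (fun u v : T => u != v).
Proof. by move=> u; rewrite eqxx. Qed.

Definition complete_graph (k : nat) : sgraph :=
  @SGraph 'I_k (fun u v => u != v) (@neq_sym _) (@neq_irr _).

(* The index set I_n; the vertices 1, ..., n are represented by 0, ..., n-1. *)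
Definition edge (n : nat) : finType := {p : 'I_n * 'I_n | (p.1 < p.2)%N}.

Definition config (n : nat) : finType := {ffun edge n -> bool}.

Definition config_adj (n : nat) (x : config n) (u v : 'I_n) : bool :=
  [exists e : edge n, x e && ((val e == (u, v)) || (val e == (v, u)))].

Definition inj_hom_count (G : sgraph) (n : nat) (x : config n) : nat :=
  #|[set f : {ffun G -> 'I_n} | injectiveb f &&
      [forall u : G, forall v : G,
         adj u v ==> config_adj x (f u) (f v)]]|.

Definition ergm_weight (R : realType) (s : nat) (beta : 'I_s -> R)
    (G : 'I_s -> sgraph) (n : nat) (x : config n) : R :=
  expR (n%:R ^+ 2 *
        \sum_(i < s) beta i * n%:R ^- #|G i| * (inj_hom_count (G i) x)%:R).

Definition ergm_Z (R : realType) (s : nat) (beta : 'I_s -> R)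
    (G : 'I_s -> sgraph) (n : nat) : R :=
  \sum_(x : config n) ergm_weight beta G x.

Lemma ergm_Z_gt0 (R : realType) (s : nat) (beta : 'I_s -> R)
    (G : 'I_s -> sgraph) (n : nat) : 0 < ergm_Z beta G n.
Proof.
rewrite /ergm_Z (bigD1 [ffun=> false]) //=.
by apply: ltr_pwDl; [exact: expR_gt0 | apply: sumr_ge0 => x _; exact: expR_ge0].
Qed.

Lemma ergm_ge0 (R : realType) (s : nat) (beta : 'I_s -> R)
    (G : 'I_s -> sgraph) (n : nat) (x : config n) :
  0 <= (ergm_Z beta G n)^-1 * ergm_weight beta G x.
Proof. by rewrite mulr_ge0 ?invr_ge0 ?expR_ge0 // ltW // ergm_Z_gt0. Qed.

Lemma ergm_sum1 (R : realType) (s : nat) (beta : 'I_s -> R)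
    (G : 'I_s -> sgraph) (n : nat) :
  \sum_(x : config n) (ergm_Z beta G n)^-1 * ergm_weight beta G x = 1.
Proof. by rewrite -mulr_sumr mulVf // gt_eqF // ergm_Z_gt0. Qed.

Definition ergm (R : realType) (s : nat) (beta : 'I_s -> R)
    (G : 'I_s -> sgraph) (n : nat) : fdist R (config n) :=
  FDist (@ergm_ge0 R s beta G n) (ergm_sum1 beta G n).

Definition triangles (n : nat) : {set {set edge n}} :=
  [set t : {set edge n} | [exists i : 'I_n, exists j : 'I_n, exists k : 'I_n,
     [&& (i < j)%N, (j < k)%N &
      [set val e | e in t]%SET == [set (i, j); (i, k); (j, k)]%SET]]]%SET.

Definition T3 (R : realType) (n : nat) (x : config n) : R :=
  \sum_(t in triangles n) \prod_(e in t) (x e)%:R.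

Definition incident (n : nat) (v : 'I_n) (e : edge n) : bool :=
  (v == (val e).1) || (v == (val e).2).

Definition share_vertex (n : nat) (e f : edge n) : bool :=
  [exists v : 'I_n, incident v e && incident v f].

(* E x_e x_f for some pair of distinct edges e, f sharing a vertex (by symmetry
   under vertex permutations the choice is immaterial); 0 if there is no such
   pair, i.e. for n < 3. *)
Definition mu2 (R : realType) (s : nat) (beta : 'I_s -> R)
    (G : 'I_s -> sgraph) (n : nat) : R :=
  if [pick p : edge n * edge n | (p.1 != p.2) && share_vertex p.1 p.2]
  is Some p
  then expect (ergm beta G n) (fun x => (x p.1)%:R * (x p.2)%:R) else 0.

(* The library's [normal_prob m s] (standard deviation [s]) is a placeholder
   uniform law when [s = 0]; N(m, 0) is the Dirac mass at m. *)
Definition gaussian (R : realType) (m s : R) :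
    probability (measurableTypeR R) R :=
  if s == 0
  then (@dirac _ (measurableTypeR R) m R : probability (measurableTypeR R) R)
  else (normal_prob m s : probability (measurableTypeR R) R).

(* Convergence in distribution of X n under P n, where each P n lives on its
   own finite probability space, to a probability measure Q on the line. *)
Definition cvg_in_distribution (R : realType) (T : nat -> finType)
    (P : forall n, fdist R (T n)) (X : forall n, T n -> R)
    (Q : probability (measurableTypeR R) R) : Prop :=
  forall h : R -> R, continuous h -> (exists M : R, forall x, `|h x| <= M) ->
    expect (P n) (fun x => h (X n x)) @[n --> \oo] --> \int[Q]_x h x.

(* Main.v *)
Require Import Defs.
From HB Require Import structures.
From mathcomp Require Import all_boot all_order all_algebra all_fingroup.
From mathcomp Require Import all_classical all_reals all_analysis.
From mathcomp Require Import zify ring lra.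

(** Applied to [f = 1 + eps g], the log-Sobolev inequality gives to second order
    in [eps] the Poincare inequality [Var g <= sigma^2 E|dg|^2].  For
    [F = T3 - (n - 2) mu2 sum_e x_e] the discrete derivative in direction [e] is
    the centred number of paths of length two closing up with [e], whose
    variance is O(n) by a second use of Poincare.  Hence [Var F = O(n^3)], while
    the normalisation squared is of order [n^4], because flipping one edge
    changes the weight by a bounded factor and so [mu2] is bounded away from 0.
    The two normalised statistics are therefore close in L2, and the central
    limit theorem passes from one to the other. *)

Set Implicit Arguments.
Unset Strict Implicit.
Unset Printing Implicit Defensive.

Import Order.TTheory GRing.Theory Num.Theory.
Import numFieldNormedType.Exports.

Local Open Scope classical_set_scope.
Local Open Scope ring_scope.

(** * Log-Sobolev implies Poincare *)

Section Expectation.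
Variables (R : realType) (T : finType) (mu : fdist R T).
Implicit Types f g : T -> R.

Definition variance f : R := expect mu (fun x => (f x - expect mu f) ^+ 2).

Lemma eq_expect f g : f =1 g -> expect mu f = expect mu g.
Proof. by move=> fg; apply: eq_bigr => x _; rewrite fg. Qed.

Lemma ler_expect f g : (forall x, f x <= g x) -> expect mu f <= expect mu g.
Proof. by move=> fg; apply: ler_sum => x _; rewrite ler_wpM2l ?fdist_ge0. Qed.

Lemma expect_ge0 f : (forall x, 0 <= f x) -> 0 <= expect mu f.
Proof. by move=> f0; apply: sumr_ge0 => x _; rewrite mulr_ge0 ?fdist_ge0. Qed.

Lemma expect_cst c : expect mu (fun=> c) = c.
Proof. by rewrite /expect -mulr_suml fdist_sum1 mul1r. Qed.

Lemma expectZ c f : expect mu (fun x => c * f x) = c * expect mu f.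
Proof. by rewrite /expect mulr_sumr; apply: eq_bigr => x _ /=; ring. Qed.

Lemma expectD f g : expect mu (fun x => f x + g x) = expect mu f + expect mu g.
Proof. by rewrite /expect -big_split; apply: eq_bigr => x _ /=; ring. Qed.

Lemma expectN f : expect mu (fun x => - f x) = - expect mu f.
Proof. by rewrite /expect -sumrN; apply: eq_bigr => x _ /=; ring. Qed.

Lemma expectB f g : expect mu (fun x => f x - g x) = expect mu f - expect mu g.
Proof. by rewrite expectD expectN. Qed.

Lemma expect_sum (J : finType) (P : pred J) (F : J -> T -> R) :
  expect mu (fun x => \sum_(j | P j) F j x) = \sum_(j | P j) expect mu (F j).
Proof.
by rewrite /expect exchange_big; apply: eq_bigr => x _; rewrite mulr_sumr.
Qed.

Lemma ler_norm_expect f : `|expect mu f| <= expect mu (fun x => `|f x|).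
Proof.
apply: le_trans (ler_norm_sum _ _ _) _; apply: ler_sum => x _.
by rewrite normrM ger0_norm ?fdist_ge0.
Qed.

End Expectation.

(** Mean value theorem on each side of 0. For [t >= 0] the quadratic polynomial alone is a lower
    bound. For [t < 0] the cubic term is [t ^+ 3], and the sign of the derivative comes from [(1 - c
    + 3 c^2)(1 + c) = 1 + c^2 (2 + 3 c)] with [c >= -1/2]. *)
Lemma ln1D_ge_cubic (R : realType) (t : R) : `|t| <= 2^-1 ->
  t - t ^+ 2 / 2 - `|t| ^+ 3 <= ln (1 + t).
Proof.
move=> th.
have D (a x : R) : -1 < x ->
    is_derive x 1 (fun u => ln (1 + u) - (u - u ^+ 2 / 2 + a * u ^+ 3))
      ((1 + x)^-1 - (1 - x + 3 * a * x ^+ 2)).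
  move=> x1.
  have l : is_derive x 1 (fun u : R => ln (1 + u)) (1 + x)^-1.
    have := @is_derive1_comp R (@ln R) (fun u => 1 + u) x (1 + x)^-1 1.
    rewrite mulr1; apply.
      by apply: is_derive1_ln; lra.
    have h := @is_deriveD R _ _ (cst (1:R)) id x 1 0 1.
    by rewrite add0r in h; apply: h.
  apply: is_derive_eq; rewrite /GRing.scale /=; lra.
have C (a b c : R) : -1 < b -> {within `[b, c], continuous (fun u =>
  ln (1 + u) - (u - u ^+ 2 / 2 + a * u ^+ 3))}.
  move=> b1; apply: derivable_within_continuous => x.
  rewrite in_itv /= => /andP[bx _].
  have [] := D a x _ => //; lra.
have [t0|t0] := leP 0 t.
  have [x|c|c] := @MVT_segment R (fun u =>
    ln (1 + u) - (u - u ^+ 2 / 2 + 0 * u ^+ 3))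
     (fun x => (1 + x)^-1 - (1 - x + 3 * 0 * x ^+ 2)) 0 t t0.
  - by rewrite in_itv /= => /andP[x0 _]; apply: D; lra.
  - by apply: C; lra.
  - rewrite in_itv /= => /andP[c0 ct]; rewrite addr0 ln1 ger0_norm// => E.
    have c1 : 0 <= (1 + c)^-1 - (1 - c + 3 * 0 * c ^+ 2).
      rewrite subr_ge0 -[leRHS]mul1r ler_pdivlMr; [nra|lra].
    have t3 : 0 <= t ^+ 3 by apply: exprn_ge0.
    have := mulr_ge0 c1 t0; nra.
have tl : -(2^-1) <= t by move: th; rewrite ltr0_norm// lerNl.
have [x|c|c] := @MVT_segment R (fun u =>
  ln (1 + u) - (u - u ^+ 2 / 2 + 1 * u ^+ 3))
     (fun x => (1 + x)^-1 - (1 - x + 3 * 1 * x ^+ 2)) t 0 (ltW t0).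
- by rewrite in_itv /= => /andP[x0 _]; apply: D; lra.
- by apply: C; lra.
- rewrite in_itv /= => /andP[tc c0]; rewrite addr0 ln1 ltr0_norm// => E.
  have c1 : (1 + c)^-1 - (1 - c + 3 * 1 * c ^+ 2) <= 0.
    rewrite subr_le0 -[leLHS]mul1r ler_pdivrMr; last lra.
    have -> : (1 - c + 3 * 1 * c ^+ 2) * (1 + c) = 1 + c ^+ 2 * (2 + 3 * c) by ring.
    by rewrite lerDl mulr_ge0 ?sqr_ge0//; lra.
  have -> : (- t) ^+ 3 = - t ^+ 3 by ring.
  have := mulr_le0_ge0 c1 (_ : 0 <= 0 - t); rewrite sub0r oppr_ge0 => /(_ (ltW t0)).
  rewrite -(sub0r t) -E; lra.
Qed.

(** For [F = 1 + e g] with [g] centred, the entropy of [F ^+ 2] is [2 e^2 V] up to a cubic error,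
    while the gradient term is exactly [e^2 A]. Dividing by [2 e^2] and letting [e] tend to 0 gives
    the claim. *)
Lemma d_LSI_poincare (R : realType) (I X : finType)
    (mu : fdist R {ffun I -> X}) (sigma2 : R) (f : {ffun I -> X} -> R) :
  d_LSI mu sigma2 -> variance mu f <= sigma2 * expect mu (d_grad_sq mu f).
Proof.
move=> lsi; set A := expect mu _.
pose g x := f x - expect mu f; pose V := variance mu f.
have Eg : expect mu g = 0 by rewrite /g expectB expect_cst subrr.
have V0 : 0 <= V by apply: expect_ge0 => x; apply: sqr_ge0.
pose M := 1 + \sum_x `|g x|.
have gM x : `|g x| <= M.
  rewrite /M (bigD1 x) //=.
  have : 0 <= \sum_(i | i != x) `|g i| by apply: sumr_ge0.
  by lra.
have M1 : 1 <= M by rewrite lerDl sumr_ge0.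
have VM : V <= M ^+ 2.
  rewrite -[leRHS](expect_cst mu); apply: ler_expect => x.
  by rewrite -/(g x) -real_normK ?num_real// ler_sqr ?nnegrE//; lra.
(* The 3 is half the sum of the cubic errors 5 in [low] and 1 in [up]. *)
have key e : 0 < e -> e * M <= 2^-1 -> V - 3 * M ^+ 3 * e <= sigma2 * A.
  move=> e0 eM; pose F x := 1 + e * g x.
  have t2 x : `|e * g x| <= 2^-1.
    apply: le_trans eM; rewrite normrM gtr0_norm//.
    by rewrite ler_pM2l.
  have tM x : `|e * g x| ^+ 3 <= (e * M) ^+ 3.
    rewrite lerXn2r ?nnegrE ?normr_ge0//; first by rewrite mulr_ge0; lra.
    by rewrite normrM gtr0_norm// ler_pM2l.
  have EF : expect mu (fun x => F x ^+ 2) = 1 + e ^+ 2 * V.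
    rewrite (@eq_expect _ _ _ _ (fun x => 1 + 2 * e * g x + e ^+ 2 * g x ^+ 2));
      last first.
      by move=> x; rewrite /F; ring.
    by rewrite !expectD expect_cst !expectZ Eg mulr0 addr0.
  have := lsi F; rewrite /Ent EF.
  have -> : expect mu (d_grad_sq mu F) = e ^+ 2 * A.
    rewrite -expectZ; apply: eq_expect => x.
    rewrite /d_grad_sq mulr_sumr; apply: eq_bigr => i _.
    rewrite /d_part_sq mulrCA; congr (_ * _).
    rewrite mulr_sumr; apply: eq_bigr => y _.
    rewrite mulr_sumr; apply: eq_bigr => z _.
    by rewrite !mulrA /F /g; congr (_ * _ * _); ring.
  have low : 3 * e ^+ 2 * V - 5 * (e * M) ^+ 3 <=
      expect mu (fun x => F x ^+ 2 * ln (F x ^+ 2)).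
    have -> : 3 * e ^+ 2 * V - 5 * (e * M) ^+ 3 = expect mu (fun x =>
        2 * e * g x + 3 * e ^+ 2 * g x ^+ 2 - 5 * (e * M) ^+ 3).
      by rewrite expectB expectD expect_cst !expectZ Eg mulr0 add0r.
    apply: ler_expect => x; rewrite /F; move: (t2 x) (tM x).
    set t := e * g x => {}t2 {}tM.
    have := ln1D_ge_cubic t2.
    move: t2; rewrite ler_norml => /andP[tl th].
    rewrite lnXn; last lra.
    have -> : 2 * e * g x = 2 * t by rewrite /t; ring.
    have -> : 3 * e ^+ 2 * g x ^+ 2 = 3 * t ^+ 2 by rewrite /t; ring.
    (* The right-hand product is [2 t + 3 t^2 - t^4 - 2 (1 + t)^2 |t|^3]. Since [|t| <= 1/2], the
       last two terms cost at most [(1/2 + 9/2) |t|^3], whence the 5. *)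
    move=> L; apply: (@le_trans _ _ (2 * ((1 + t) ^+ 2 * (t - t ^+ 2 / 2 - `|t|
      ^+ 3)))); last first.
      rewrite -[ln _ *+ 2]mulr_natl [leRHS]mulrCA ler_pM2l// ler_wpM2l ?sqr_ge0//.
    have [t0 cube] : 0 <= `|t| /\ t ^+ 2 = `|t| ^+ 2 by rewrite real_normK
      ?num_real.
    have t12 : `|t| <= 2^-1 by rewrite ler_norml tl.
    have c3 : 0 <= `|t| ^+ 3 by rewrite exprn_ge0.
    have : t ^+ 4 <= `|t| ^+ 3 / 2.
      have -> : t ^+ 4 = `|t| ^+ 3 * `|t| by rewrite -[4%N]/(2 * 2)%N exprM cube;
        ring.
      exact: ler_wpM2l.
    have : (1 + t) ^+ 2 * `|t| ^+ 3 <= 9 / 4 * `|t| ^+ 3.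
      by rewrite ler_wpM2r//; nra.
    lra.
  (* With [u = e ^+ 2 * V], [ln (1 + u) <= u] leaves the error [u^2 <= (e M)^4], and [e M <= 1]. *)
  have up : (1 + e ^+ 2 * V) * ln (1 + e ^+ 2 * V) <= e ^+ 2 * V + (e * M) ^+ 3 .
    have eV0 : 0 <= e ^+ 2 * V by rewrite mulr_ge0 ?sqr_ge0.
    have eVM : e ^+ 2 * V <= (e * M) ^+ 2 by rewrite exprMn ler_wpM2l ?sqr_ge0.
    have eM0 : 0 <= e * M by rewrite mulr_ge0; lra.
    apply: (@le_trans _ _ ((1 + e ^+ 2 * V) * (e ^+ 2 * V))).
      by rewrite ler_wpM2l ?le_ln1Dx//; lra.
    rewrite mulrDl mul1r lerD2l.
    apply: (@le_trans _ _ ((e * M) ^+ 2 * (e * M) ^+ 2)); first by rewrite ler_pM.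
    by rewrite -exprD [leLHS]exprS; rewrite -[leRHS]mul1r ler_wpM2r ?exprn_ge0//;
      lra.
  move=> H.
  have : e ^+ 2 * (V - 3 * M ^+ 3 * e) <= e ^+ 2 * (sigma2 * A).
    have : 3 * M ^+ 3 * e * e ^+ 2 = 3 * (e * M) ^+ 3 by ring.
    by move: H low up; lra.
  by rewrite ler_pM2l// exprn_gt0.
rewrite -/V; apply/ler_addgt0Pr => d d0.
pose C := 3 * M ^+ 3.
have C0 : 0 < C by rewrite mulr_gt0// exprn_gt0//; lra.
pose e := Num.min ((2 * M)^-1) (d / C).
have e0 : 0 < e by rewrite lt_min invr_gt0 divr_gt0// andbT mulr_gt0//; lra.
have := key e e0; rewrite -/C.
have -> : e * M <= 2^-1.
  have -> : 2^-1 = (2 * M)^-1 * M :> R by field; lra.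
  by rewrite ler_pM2r ?ge_min ?lexx//; lra.
have : C * e <= d by rewrite mulrC -ler_pdivlMr// ge_min lexx orbT.
by move=> ? /(_ isT); lra.
Qed.

(** * Single-coordinate flips of boolean configurations *)

Definition flip_diff (R : realType) (I : finType) (f : {ffun I -> bool} -> R)
    (i : I) (x : {ffun I -> bool}) : R :=
  f (upd x i true) - f (upd x i false).

Lemma cond_law_itv (R : realType) (I X : finType)
    (mu : fdist R {ffun I -> X}) (i : I) (x : {ffun I -> X}) (y : X) :
  0 <= cond_law mu i x y <= 1.
Proof.
have s0 : 0 <= \sum_z mu (upd x i z) by apply: sumr_ge0 => z _; apply: fdist_ge0.
rewrite /cond_law divr_ge0 ?fdist_ge0//=.
(* On a null fibre the conditional law is identically 0 by the convention for division. *)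
have [->|sn0] := eqVneq (\sum_z mu (upd x i z)) 0; first by rewrite invr0 mulr0.
rewrite ler_pdivrMr ?lt_neqAle 1?eq_sym ?sn0// mul1r (bigD1 y) //= lerDl.
by apply: sumr_ge0 => z _; apply: fdist_ge0.
Qed.

(** On a two-point fibre the squared local gradient is [q * p] times the squared flip difference,
    [q] and [p] being the conditional probabilities. Bounding [q * p] by 1 removes the conditional
    laws. *)
Lemma poincare_flip (R : realType) (I : finType)
    (mu : fdist R {ffun I -> bool}) (sigma2 : R) (f : {ffun I -> bool} -> R) :
  0 <= sigma2 -> d_LSI mu sigma2 ->
  variance mu f <=
    sigma2 * \sum_i expect mu (fun x => flip_diff f i x ^+ 2).
Proof.
move=> s0 lsi; apply: le_trans (d_LSI_poincare f lsi) _.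
rewrite -expect_sum ler_wpM2l//; apply: ler_expect => x.
apply: ler_sum => i _.
rewrite /d_part_sq !big_bool /= /flip_diff.
set a := f _; set b := f _.
have := cond_law_itv mu i x true; have := cond_law_itv mu i x false.
set p := cond_law _ _ _ _; set q := cond_law _ _ _ _.
move=> /andP[p0 p1] /andP[q0 q1].
have pq : q * p <= 1 by rewrite mulr_ile1.
have -> : 2^-1 * ((a - a) ^+ 2 * q * q + (a - b) ^+ 2 * q * p +
   ((b - a) ^+ 2 * p * q + (b - b) ^+ 2 * p * p)) = (a - b) ^+ 2 * (q * p) by field.
by rewrite ler_piMr ?sqr_ge0.
Qed.

Lemma updE (I X : finType) (x : {ffun I -> X}) (i : I) (y : X) (j : I) :
  upd x i y j = if j == i then y else x j.
Proof. by rewrite ffunE. Qed.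

Lemma upd_mono (I : finType) (x : {ffun I -> bool}) (i j : I) :
  upd x i false j -> upd x i true j.
Proof. by rewrite !updE; case: eqP. Qed.

Lemma upd_off (I : finType) (x : {ffun I -> bool}) (i j : I) (y z : bool) :
  j != i -> upd x i y j -> upd x i z j.
Proof. by rewrite !updE => /negbTE ->. Qed.

Lemma upd_same (I X : finType) (x : {ffun I -> X}) (i : I) (y : X) :
  x i = y -> upd x i y = x.
Proof. by move=> <-; apply/ffunP => j; rewrite ffunE; case: eqP => // ->. Qed.

Lemma upd_upd (I X : finType) (x : {ffun I -> X}) (i : I) (y z : X) :
  upd (upd x i y) i z = upd x i z.
Proof. by apply/ffunP => j; rewrite !ffunE; case: eqP. Qed.

(** Flipping coordinate [i] carries the configurations with [x i] false bijectively to those with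
    [x i] true. It leaves [g] unchanged and costs a factor at most [K], so the false part of the
    mean is at most [K] times the true part. *)
Lemma expect_coord_ge (R : realType) (I : finType)
    (mu : fdist R {ffun I -> bool}) (K : R) (i : I) (g : {ffun I -> bool} -> R) :
  (forall x, mu (upd x i false) <= K * mu (upd x i true)) ->
  (forall x, 0 <= g x) -> (forall x y, g (upd x i y) = g x) ->
  expect mu g <= (1 + K) * expect mu (fun x => (x i)%:R * g x).
Proof.
move=> hK g0 gi.
pose flip (x : {ffun I -> bool}) := upd x i (~~ x i).
have flipK : involutive flip.
  by move=> x; rewrite /flip upd_upd ffunE eqxx negbK upd_same.
have split : expect mu g = expect mu (fun x => (x i)%:R * g x) +
                           expect mu (fun x => (~~ x i)%:R * g x).
  rewrite -expectD; apply: eq_expect => x; case: (x i); rewrite /=; ring.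
rewrite split mulrDl mul1r lerD2l {1}/expect (reindex_inj (inv_inj flipK)) /=.
rewrite -expectZ; apply: ler_sum => x _.
rewrite /flip !ffunE eqxx negbK gi.
have [xi|xi] := boolP (x i); last by rewrite !mul0r !mulr0.
rewrite /= !mul1r mulrA ler_wpM2r//.
by have := hK x; rewrite (upd_same xi) mulrC.
Qed.

(** * Convergence in distribution under L2 perturbations *)

(** Heine-Cantor with only [x] confined to the segment: in the application nothing confines the
    perturbed variable [y]. *)
Lemma continuous_unif_on_segment (R : realType) (h : R -> R) (K e : R) :
  continuous h -> 0 < e ->
  exists2 d : R, 0 < d &
    forall x y, `|x| <= K -> `|x - y| < d -> `|h x - h y| <= e.
Proof.
move=> ch e0.
have /compact_near_coveringP cov := @segment_compact R (- K) K.
have := cov R (0%R^'+) (fun d x => forall y, `|x - y| < d -> `|h x - h y| <= e) _.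
have loc x : `[- K, K]%classic x -> \forall x' \near x & d \near 0%R^'+,
    forall y, `|x' - y| < d -> `|h x' - h y| <= e.
  move=> _.
  have [r r0 hr] : exists2 r : R, 0 < r & forall z,
    `|x - z| < r -> `|h x - h z| < e / 2.
    have e2 : 0 < e / 2 by rewrite divr_gt0.
    have /cvgrPdist_lt /(_ _ e2) /nbhs_ballP [r r0 hr] := ch x.
    by exists r => // z; apply: hr.
  have r20 : 0 < r / 2 by rewrite divr_gt0.
  exists (ball x (r / 2), [set d | d < r / 2]).
    split; [exact: nbhsx_ballx | exact: nbhs_right_lt].
  move=> [x' d] [/= bx dr] y xy.
  have h1 : `|h x - h x'| < e / 2.
    by apply: hr; apply: lt_trans bx _; lra.
  have h2 : `|h x - h y| < e / 2.
    apply: hr; have := ler_distD x' x y; move: bx; rewrite /ball /=; lra.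
  have := ler_distD (h x) (h x') (h y); rewrite (distrC (h x') (h x)); lra.
move=> /(_ _ loc) H.
have [d [d0 hd]] : exists d : R, 0 < d /\
    (`[- K, K]%classic `<=` (fun x => forall y, `|x - y| < d -> `|h x - h y| <= e)).
  apply: (@filter_ex _ (0%R^'+)); near=> d; split; first by near: d;
    exact: nbhs_right_gt.
  by near: d; exact: H.
exists d => // x y xK; apply: hd; rewrite /= in_itv /=.
by move: xK; rewrite ler_norml.
Unshelve. all: by end_near.
Qed.

(** A pointwise Chebyshev bound, ready to be integrated. Uniform continuity gives [e] when [x] is in
    the segment and [y] is near [x]; otherwise one of the quadratic terms already exceeds the
    trivial bound [2 * M]. *)
Lemma continuous_bounded_dist (R : realType) (h : R -> R) (M K e : R) :
  continuous h -> (forall x, `|h x| <= M) -> 0 < K -> 0 < e ->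
  exists2 d : R, 0 < d & forall x y,
    `|h x - h y| <= e + 2 * M / K ^+ 2 * x ^+ 2 + 2 * M / d ^+ 2 * (x - y) ^+ 2.
Proof.
move=> ch hM K0 e0; have [d d0 hd] := continuous_unif_on_segment K ch e0.
have M0 : 0 <= M by apply: le_trans (hM 0).
exists d => // x y.
have far (a z : R) : 0 < a -> a <= `|z| -> 2 * M <= 2 * M / a ^+ 2 * z ^+ 2.
  move=> a0 az; rewrite -mulrA ler_peMr ?mulr_ge0// mulrC ler_pdivlMr ?exprn_gt0//.
  by rewrite mul1r -[leRHS]real_normK ?num_real// lerXn2r ?nnegrE// ltW.
have pos (a z : R) : 0 <= 2 * M / a ^+ 2 * z ^+ 2.
  by rewrite mulr_ge0 ?sqr_ge0// divr_ge0 ?sqr_ge0 ?mulr_ge0.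
have hxy : `|h x - h y| <= 2 * M.
  by apply: le_trans (ler_normB _ _) _; have := hM x; have := hM y; lra.
have := pos K x; have := pos d (x - y).
have [xK|/ltW/(far _ _ K0)] := leP `|x| K; last by lra.
have [|/(far _ _ d0)] := ltP `|x - y| d; last by lra.
by move=> /(hd _ _ xK); lra.
Qed.

(* Bounded second moments of [X n] supply the tightness that makes uniform
   continuity of the test function on a segment sufficient. *)
Lemma cvg_in_distribution_L2 (R : realType) (T : nat -> finType)
    (P : forall n, fdist R (T n)) (X Y : forall n, T n -> R)
    (Q : probability (measurableTypeR R) R) (C : R) :
  (forall n, expect (P n) (fun x => X n x ^+ 2) <= C) ->
  expect (P n) (fun x => (X n x - Y n x) ^+ 2) @[n --> \oo] --> (0 : R) ->
  cvg_in_distribution P X Q -> cvg_in_distribution P Y Q.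
Proof.
move=> XC XY cX h ch [M hM].
have M0 : 0 <= M by apply: le_trans (hM 0).
have C0 : 0 <= C.
  by apply: le_trans (XC 0%N); apply: expect_ge0 => x; exact: sqr_ge0.
pose D n := expect (P n) (fun x => h (X n x)) - expect (P n) (fun x => h (Y n x)).
have D0 : D n @[n --> \oo] --> (0 : R).
  apply/cvgr0Pnorm_le => e e0.
  (* Then [e / 3 * K >= 2 * M * C], and [K <= K ^+ 2] because [K >= 1], so the tail term is at most
     [e / 3]. *)
  pose K := 1 + 6 * M * C / e.
  have K1 : 1 <= K by rewrite lerDl divr_ge0 ?(ltW e0)// !mulr_ge0.
  have e3 : 0 < e / 3 by rewrite divr_gt0.
  have [d d0 hd] := continuous_bounded_dist ch hM (lt_le_trans ltr01 K1) e3.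
  have KC : 2 * M / K ^+ 2 * C <= e / 3.
    rewrite mulrAC ler_pdivrMr ?exprn_gt0//; last lra.
    apply: (@le_trans _ _ (e / 3 * K)); last by rewrite ler_pM2l// ler_eXnr.
    have -> : e / 3 * K = e / 3 + 2 * M * C by rewrite /K; field; lra.
    by lra.
  pose c := 2 * M / d ^+ 2.
  have c0 : 0 <= c by rewrite divr_ge0 ?sqr_ge0 ?mulr_ge0.
  (* Dividing by [1 + c] instead of [c] covers the case [M = 0], where [c] vanishes. *)
  have b0 : 0 < e / 3 / (1 + c) by rewrite divr_gt0//; lra.
  have /cvgr0Pnorm_le /(_ _ b0) := XY.
  apply: filterS => n; set w := expect _ _ => wb.
  have {wb}wb : c * w <= e / 3.
    have w0 : 0 <= w by apply: expect_ge0 => x; exact: sqr_ge0.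
    move: wb; rewrite ger0_norm// ler_pdivlMr; last lra.
    by nra.
  rewrite /D -expectB; apply: le_trans (ler_norm_expect _ _) _.
  have := ler_expect (P n) (fun x => hd (X n x) (Y n x)).
  rewrite !expectD !expectZ expect_cst -/w => H; apply: le_trans H _.
  have : 2 * M / K ^+ 2 * expect (P n) (fun x => X n x ^+ 2) <= 2 * M / K ^+ 2 * C.
    by rewrite ler_wpM2l// divr_ge0 ?sqr_ge0 ?mulr_ge0.
  by move: wb; rewrite /c; lra.
have -> : (fun n => expect (P n) (fun x => h (Y n x))) =
    (fun n => expect (P n) (fun x => h (X n x)) - D n).
  by apply/funext => n; rewrite /D; ring.
by rewrite -[X in _ --> X]subr0; apply: cvgB => //; apply: cX => //; exists M.
Qed.

(** * Triangles in the complete graph *)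

Section Triangles.
Import mathcomp.boot.finset.
Local Open Scope set_scope.

Variable n : nat.
Implicit Types (u v w : 'I_n) (e f g : edge n) (S : {set 'I_n}).

(** Forgetting the order of the endpoints spares case distinctions when edges are compared or
    permuted. *)
Definition ends e : {set 'I_n} := [set (val e).1; (val e).2].

Lemma card_ends e : #|ends e| = 2%N.
Proof. by rewrite cards2 neq_ltn (valP e). Qed.

Lemma endsP e u v : ends e = [set u; v] -> (u < v)%N -> val e = (u, v).
Proof.
move=> E uv; have := valP e; move/setP: E; rewrite /ends.
case: (val e) => a b /= E ab.
have := E a; have := E b; rewrite !inE !eqxx orbT /= => /esym hb /esym ha.
case/orP: ha => /eqP ha; case/orP: hb => /eqP hb; subst => //; lia.
Qed.

Lemma ends_inj : injective ends.
Proof. by move=> e f E; apply/val_inj;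
  rewrite (endsP E) ?(valP f) -?surjective_pairing. Qed.

Lemma ends_onto u v : u != v -> exists e, ends e = [set u; v].
Proof.
rewrite neq_ltn => /orP[uv|vu].
  by exists (exist _ (u, v) uv).
by exists (exist _ (v, u) vu); rewrite setUC.
Qed.

Lemma card_edge_le : (#|edge n| <= 'C(n, 2))%N.
Proof.
rewrite -[X in 'C(X, _)](card_ord n) -card_draws -(card_imset _ ends_inj).
by apply: subset_leq_card; apply/fintype.subsetP => _ /imsetP[e _ ->];
  rewrite inE card_ends.
Qed.

Lemma share_vertexE e f : share_vertex e f = (ends e :&: ends f != set0).
Proof. by apply/existsP/set0Pn => -[v H]; exists v; move: H; rewrite !inE. Qed.

(** The complete graph on [S]; for three vertices it is the triangle on them. *)
Definition induced S : {set edge n} := [set e | ends e \subset S].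

Lemma imset_val_induced u v w : (u < v)%N -> (v < w)%N ->
  val @: induced [set u; v; w] = [set (u, v); (u, w); (v, w)].
Proof.
move=> uv vw; apply/setP => -[a b]; apply/imsetP/idP => [[e]|].
  rewrite inE => + ->; have := valP e; rewrite /ends; case: (val e) =>
    {}a {}b /= ab.
  rewrite subUset !sub1set !inE !xpair_eqE -!orbA.
  by case/andP=> /or3P[] /eqP ? /or3P[] /eqP ?; subst; rewrite ?eqxx ?orbT//; lia.
rewrite !inE !xpair_eqE -!orbA => H.
have ab : (a < b)%N by case/or3P: H => /andP[/eqP-> /eqP->] //; lia.
exists (exist _ (a, b) ab) => //; rewrite inE /ends /= subUset !sub1set !inE.
by case/or3P: H => /andP[/eqP-> /eqP->]; rewrite !eqxx ?orbT.
Qed.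

Lemma card3_sorted S : #|S| = 3%N ->
  exists u v w, [/\ (u < v)%N, (v < w)%N & S = [set u; v; w]].
Proof.
have : sorted (relpre val ltn) (enum S).
  rewrite /enum_mem; apply: sorted_filter; first by move=> ? ? ?; apply: ltn_trans.
  rewrite -sorted_map -/(enum 'I_n) -enumT val_enum_ord; exact: iota_ltn_sorted.
rewrite cardE; case E: (enum S) => [|u [|v [|w []]]] //= /and3P[uv vw _] _.
by exists u, v, w; split => //; apply/setP => z; rewrite -mem_enum E !inE orbA.
Qed.

(** Triangles become three-element vertex sets, so that the counts below need no ordering of the
    vertices. *)
Lemma trianglesP (t : {set edge n}) :
  reflect (exists2 S : {set 'I_n}, #|S| = 3%N & t = induced S) (t \in triangles n).
Proof.
apply: (iffP idP) => [|[S]].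
  rewrite inE => /existsP[u /existsP[v /existsP[w /and3P[uv vw /eqP E]]]].
  exists [set u; v; w].
    by rewrite -setUA cardsU1 cards2 !inE; case: eqP => [|_]; case: eqP => [|_];
      case: eqP => [|_] //; try lia; move=> /(congr1 val) /=; lia.
  by apply/(imset_inj val_inj); rewrite imset_val_induced.
move=> /card3_sorted[u [v [w [uv vw ->]]]] ->.
rewrite inE; apply/existsP; exists u; apply/existsP; exists v; apply/existsP;
  exists w.
by rewrite uv vw imset_val_induced /=.
Qed.

Lemma card_triangle t : t \in triangles n -> #|t| = 3%N.
Proof.
rewrite inE => /existsP[u /existsP[v /existsP[w /and3P[uv vw /eqP E]]]].
rewrite -(card_imset _ val_inj) E -setUA cardsU1 cards2 !inE !xpair_eqE !negb_or.
have neq_lt (a b : 'I_n) : (a < b)%N -> a == b = false by move=> ab; apply: ltn_eqF.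
by rewrite !eqxx !neq_lt.
Qed.

Lemma card_endsU e f : e != f -> (3 <= #|ends e :|: ends f|)%N.
Proof.
apply: contraNT; rewrite -ltnNge ltnS => le2; apply/eqP/ends_inj.
have eU : ends e = ends e :|: ends f.
  by apply/eqP; rewrite eqEcard subsetUl card_ends.
by rewrite eU; apply/eqP; rewrite eq_sym eqEcard subsetUr card_ends.
Qed.

(** Two pairs inside a three-element set must meet, by inclusion-exclusion. *)
Lemma triangle_share t e f : t \in triangles n -> e \in t -> f \in t ->
  share_vertex e f.
Proof.
case/trianglesP => S S3 ->; rewrite !inE share_vertexE => eS fS.
rewrite -card_gt0.
have : (#|ends e :|: ends f| <= 3)%N by rewrite -S3 subset_leq_card// subUset eS.
by have := cardsUI (ends e) (ends f); rewrite !card_ends; lia.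
Qed.

(** Two distinct edges span at least three vertices, hence all the vertices of any triangle
    containing both. *)
Lemma triangle_uniq t t' e f : e != f -> t \in triangles n -> t' \in triangles n ->
  e \in t -> f \in t -> e \in t' -> f \in t' -> t = t'.
Proof.
move=> ef /trianglesP[S S3 ->] /trianglesP[S' S3' ->]; rewrite !inE =>
  eS fS eS' fS'.
have U (A : {set 'I_n}) : #|A| = 3%N -> ends e \subset A -> ends f \subset A ->
  ends e :|: ends f = A.
  by move=> A3 eA fA; apply/eqP; rewrite eqEcard subUset eA fA A3 card_endsU.
by rewrite -(U S)// -(U S').
Qed.

(** A triangle through [e] is determined by its third vertex, which is any vertex outside
    [ends e]. *)
Lemma card_triangles_edge e : #|[set t in triangles n | e \in t]| = (n - 2)%N.
Proof.
(* The edge [g] from [w] to an endpoint of [e] lies in both triangles, which forces [w] to be the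
   third vertex of the other one. *)
have dI : {in ~: ends e &, injective (fun w => induced (w |: ends e))}.
  move=> w w' we _ E; move: we; rewrite inE => we.
  have [g gE] : exists g, ends g = [set w; (val e).1].
    by apply: ends_onto; move: we; rewrite !inE negb_or => /andP[].
  have : g \in induced (w |: ends e).
    by rewrite inE gE subUset !sub1set !inE !eqxx /= orbT.
  rewrite E inE gE subUset sub1set in_setU1 (negbTE we) orbF.
  by case/andP => /eqP.
have -> : [set t in triangles n | e \in t] =
    [set induced (w |: ends e) | w in ~: ends e].
  apply/setP => t; apply/idP/imsetP.
    rewrite inE => /andP[/trianglesP[S S3 ->]]; rewrite inE => eS.
    have : #|S :\: ends e| == 1%N.
      by rewrite cardsD (setIidPr eS) S3 card_ends.
    case/cards1P => w E; exists w; first by have := set11 w; rewrite -E !inE =>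
      /andP[].
    by congr induced; rewrite -E setUC; apply/setP => z; rewrite !inE;
      have := fintype.subsetP eS z; rewrite !inE; case: (_ || _) => // ->.
  case=> w we ->; rewrite in_setC in we; rewrite in_set; apply/andP; split;
    last by rewrite in_set subsetUr.
    by apply/trianglesP; exists (w |: ends e) => //; rewrite cardsU1 we card_ends.
by rewrite card_in_imset// cardsCs setCK card_ends card_ord.
Qed.
End Triangles.

(** * Invariance of the model under vertex permutations *)

Section Relabelling.
Import mathcomp.boot.finset.
Local Open Scope set_scope.
Variable n : nat.
Implicit Types (u v w : 'I_n) (e f g : edge n) (x : config n) (p : {perm 'I_n}).

Lemma ends_eq2 e u v :
  ((val e == (u, v)) || (val e == (v, u))) = (ends e == [set u; v]).
Proof.
apply/orP/eqP => [[]/eqP E|E]; rewrite /ends ?E //=; first by rewrite setUC.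
have [uv|vu|uv] := ltngtP u v.
- by left; rewrite (endsP E uv).
- by right; rewrite (endsP (v := u) _ vu)// E setUC.
- by have := card_ends e; rewrite E (val_inj uv) setUid cards1.
Qed.

Lemma config_adjE x e u v : ends e = [set u; v] -> config_adj x u v = x e.
Proof.
move=> E; apply/existsP/idP => [[f /andP[xf]]|xe].
  by rewrite ends_eq2 -E => /eqP/ends_inj <-.
by exists e; rewrite xe ends_eq2 E eqxx.
Qed.

Lemma config_adj_irr x u : config_adj x u u = false.
Proof.
apply/existsP => -[e /andP[_]]; rewrite ends_eq2 => /eqP E.
by have := card_ends e; rewrite E setUid cards1.
Qed.

(** The pullback of the graph [x] along [p]. It goes through [config_adj] because [p] may reverse
    the order of the endpoints of an edge. *)
Definition relabel p x : config n :=
  [ffun e => config_adj x (p (val e).1) (p (val e).2)].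

Lemma config_adj_relabel p x u v :
  config_adj (relabel p x) u v = config_adj x (p u) (p v).
Proof.
have [->|uv] := eqVneq u v; first by rewrite !config_adj_irr.
have [e E] := ends_onto uv.
have [f F] : exists f, ends f = [set p u; p v].
  by apply: ends_onto; rewrite (inj_eq perm_inj).
rewrite (config_adjE _ E) (config_adjE _ F) ffunE; apply: config_adjE.
have imE (a b : 'I_n) : [set p a; p b] = p @: [set a;
  b] by rewrite imsetU !imset_set1.
by rewrite F !imE -E.
Qed.

Lemma relabelM p q x : relabel p (relabel q x) = relabel (p * q)%g x.
Proof. by apply/ffunP => e; rewrite !ffunE config_adj_relabel !permM. Qed.

Lemma relabel1 x : relabel 1%g x = x.
Proof. by apply/ffunP => e; rewrite ffunE !perm1; apply: config_adjE. Qed.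

Lemma relabel_inj p : injective (relabel p).
Proof.
by apply: (can_inj (g := relabel p^-1%g)) => x; rewrite relabelM mulVg relabel1.
Qed.

Definition is_inj_hom (H : sgraph) x (h : {ffun H -> 'I_n}) : bool :=
  injectiveb h && [forall u : H, forall v : H,
    adj u v ==> config_adj x (h u) (h v)].

(* The set in [inj_hom_count] parses as a classical one. *)
Lemma inj_hom_countE (H : sgraph) x : inj_hom_count H x = #|@is_inj_hom H x|.
Proof. by apply: eq_card => h; apply/idP/idP => [/set_mem|/mem_set]. Qed.

(** Composition with [p] is a bijection from the embeddings into [relabel p x] to those into [x]. *)
Lemma inj_hom_count_relabel (H : sgraph) p x :
  inj_hom_count H (relabel p x) = inj_hom_count H x.
Proof.
pose push (h : {ffun H -> 'I_n}) : {ffun H -> 'I_n} := [ffun u => p (h u)].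
have push_inj : injective push.
  by move=> h k /ffunP E; apply/ffunP => u; have := E u; rewrite !ffunE =>
    /perm_inj.
rewrite !inj_hom_countE -(card_imset _ push_inj); apply: eq_card => k.
apply/imsetP/idP => [[h]|].
  rewrite unfold_in => /andP[/injectiveP hi /forallP hE] ->; apply/andP; split.
    by apply/injectiveP => u v; rewrite !ffunE => /perm_inj/hi.
  apply/forallP => u; apply/forallP => v; have /forallP/(_ v) := hE u.
  by rewrite config_adj_relabel !ffunE.
rewrite unfold_in => /andP[/injectiveP ki /forallP kE].
exists [ffun u => p^-1%g (k u)]; last by apply/ffunP => u; rewrite !ffunE permKV.
rewrite unfold_in; apply/andP; split.
  by apply/injectiveP => u v; rewrite !ffunE => /perm_inj/ki.
apply/forallP => u; apply/forallP => v; have /forallP/(_ v) := kE u.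
by rewrite config_adj_relabel !ffunE !permKV.
Qed.

Lemma perm_triple a b c a' b' c' : a != b -> a != c -> b != c ->
  a' != b' -> a' != c' -> b' != c' ->
  exists p : {perm 'I_n}, [/\ p a = a', p b = b' & p c = c'].
Proof.
move=> ab ac bc ab' ac' bc'.
(* Each transposition puts one more point in place and fixes the targets already reached. *)
pose p1 := tperm a a'; pose p2 := tperm (p1 b) b'; pose p3 := tperm (p2 (p1 c)) c'.
have p1a : p1 a = a' by rewrite tpermL.
have p2a : p2 a' = a'.
  by rewrite tpermD//; [rewrite -p1a (inj_eq perm_inj) eq_sym|rewrite eq_sym].
have p2b : p2 (p1 b) = b' by rewrite tpermL.
exists (p1 * p2 * p3)%g; split; rewrite !permM.
- rewrite p1a p2a tpermD// 1?eq_sym//.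
  by rewrite -{1}p2a -p1a !(inj_eq perm_inj).
- by rewrite p2b tpermD// 1?eq_sym// -p2b !(inj_eq perm_inj).
- by rewrite tpermL.
Qed.

Lemma share_vertex_ends e f : e != f -> share_vertex e f ->
  exists a b c, [/\ a != b, a != c, b != c, ends e = [set a;
    b] & ends f = [set a; c]].
Proof.
move=> ef; rewrite share_vertexE => /set0Pn[a]; rewrite inE => /andP[ae af].
have other g : a \in ends g -> exists2 b, a != b & ends g = [set a; b].
  move=> ag; have /eqP : #|ends g :\ a| = 1%N by have := card_ends g;
    rewrite (cardsD1 a) ag; lia.
  case/cards1P => b E; exists b; last by rewrite -E setD1K.
  by have := set11 b; rewrite -E !inE => /andP[]; rewrite eq_sym.
have [b ab eE] := other _ ae; have [c ac fE] := other _ af.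
exists a, b, c; split=> //; apply: contraNneq ef => bc.
by apply/eqP/ends_inj; rewrite eE fE bc.
Qed.

End Relabelling.

Section Symmetry.
Variables (R : realType) (s : nat) (beta : 'I_s -> R) (G : 'I_s ->
  sgraph) (n : nat).

Lemma ergm_relabel (p : {perm 'I_n}) (x : config n) :
  ergm beta G n (relabel p x) = ergm beta G n x.
Proof.
rewrite /= /ergm_weight; congr (_ * expR (_ * _)).
by apply: eq_bigr => i _; rewrite inj_hom_count_relabel.
Qed.

(** Two distinct adjacent edges form a path on three vertices. Vertex permutations act transitively
    on such paths and preserve the law. *)
Lemma expect_adjacent_edges (e f e' f' : edge n) :
  e != f -> share_vertex e f -> e' != f' -> share_vertex e' f' ->
  expect (ergm beta G n) (fun x => (x e)%:R * (x f)%:R) =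
  expect (ergm beta G n) (fun x => (x e')%:R * (x f')%:R).
Proof.
move=> ef /(share_vertex_ends ef)[a [b [c [ab ac bc eE fE]]]].
move=> ef' /(share_vertex_ends ef')[a' [b' [c' [ab' ac' bc' eE' fE']]]].
have [p [pa pb pc]] := perm_triple ab ac bc ab' ac' bc'.
rewrite {1}/expect (reindex_inj (@relabel_inj n p)) /=.
apply: eq_bigr => x _;
  rewrite -[_ * ergm_weight _ _ _]/(ergm beta G n _) ergm_relabel.
rewrite -(config_adjE _ eE) -(config_adjE _ fE) !config_adj_relabel pa pb pc.
by rewrite (config_adjE _ eE') (config_adjE _ fE').
Qed.

Lemma mu2E (e f : edge n) : e != f -> share_vertex e f ->
  mu2 beta G n = expect (ergm beta G n) (fun x => (x e)%:R * (x f)%:R).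
Proof.
move=> ef sh; rewrite /mu2; case: pickP => [[e' f'] /= /andP[]|/(_ (e, f))/=].
  by move=> *; apply: expect_adjacent_edges.
by rewrite ef sh.
Qed.

End Symmetry.

(** * Lower bound on the edge density *)

Section EdgeFlip.
Import mathcomp.boot.finset.
Local Open Scope set_scope.
Variable n : nat.
Implicit Types (e f : edge n) (x : config n).

(** Two prescribed values leave the other coordinates free. The factor [n ^ 2] on the left avoids a
    truncated subtraction in the exponent. *)
Lemma card_ffun_fix2 (H : finType) (u v : H) (a b : 'I_n) : u != v ->
  (n ^ 2 * #|[pred h : {ffun H -> 'I_n} | (h u == a) && (h v == b)]| = n ^ #|H|)%N.
Proof.

move=> uv.
pose F w : pred 'I_n := if w == u then pred1 a else if w == v then pred1 b else
  predT.
have vu : v == u = false by rewrite eq_sym (negbTE uv).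
have -> : #|[pred h : {ffun H -> 'I_n} | (h u == a) && (h v == b)]| = #|family F|.
  apply: eq_card => h; rewrite inE; apply/andP/familyP => [[hu hv] w|hF].
    by rewrite /F; case: eqP => [->//|_]; case: eqP => [->|].
  by have := hF u; have := hF v; rewrite /F !eqxx vu !inE.
have split2 (k : H -> nat) :
    (\prod_w k w = k u * (k v * \prod_(w | (w != u) && (w != v)) k w))%N.
  by rewrite (bigD1 u) //= (bigD1 v) //= eq_sym.
rewrite card_family foldrE big_map big_enum /= -prod_nat_const !split2.
rewrite /F !eqxx vu !card1 !mul1n mulnA; congr (_ * _)%N.
by apply: eq_bigr => w /andP[/negbTE -> /negbTE ->]; rewrite card_ord.
Qed.

Lemma inj_hom_count_mono (H : sgraph) (x y : config n) :
  (forall f, x f -> y f) -> (inj_hom_count H x <= inj_hom_count H y)%N.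
Proof.
move=> xy; rewrite !inj_hom_countE; apply: subset_leq_card;
  apply/fintype.subsetP => h.
rewrite unfold_in => /andP[hi /forallP hE]; rewrite unfold_in; apply/andP;
  split=> //.
apply/forallP => u; apply/forallP => v; apply/implyP => uv.
have /forallP/(_ v)/implyP/(_ uv)/existsP[f /andP[/xy yf fE]] := hE u.
by apply/existsP; exists f; rewrite fE yf.
Qed.

(** An embedding into [y] that is not one into [x] uses [e], so it sends some ordered pair of
    distinct vertices of [H] to the endpoints of [e]. There are at most [#|H| ^ 2] such pairs, and
    [card_ffun_fix2] counts the maps for each. *)
Lemma inj_hom_count_local (H : sgraph) (x y : config n) e :
  (forall f, f != e -> y f -> x f) ->
  (n ^ 2 * inj_hom_count H y <=
   n ^ 2 * inj_hom_count H x + #|H| ^ 2 * n ^ #|H|)%N.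
Proof.
move=> yx.
pose fix2 (q : H * H) := [pred h : {ffun H -> 'I_n} |
  (h q.1 == (val e).1) && (h q.2 == (val e).2)].
have sub : (inj_hom_count H y <= inj_hom_count H x +
    \sum_(q : H * H | q.1 != q.2) #|fix2 q|)%N.
  rewrite !inj_hom_countE.
  pose P := [pred h : {ffun H -> 'I_n} |
    [exists q : H * H, (q.1 != q.2) && fix2 q h]].
  have H1 : (#|@is_inj_hom n H y| <= #|[predU @is_inj_hom n H x & P]|)%N.
    apply: subset_leq_card; apply/fintype.subsetP => h h1.
    have [|/existsPn nofix] := boolP (P h).
      by move=> Ph; apply/orP; right.
    apply/orP; left; move: h1; rewrite unfold_in => /andP[hi /forallP hE];
      apply/andP; split=> //.
    apply/forallP => u; apply/forallP => v; apply/implyP => uv.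
    have uv' : u != v by apply: contraTneq uv => ->; rewrite adj_irr.
    have /forallP/(_ v)/implyP/(_ uv)/existsP[f /andP[xf fE]] := hE u.
    apply/existsP; exists f; rewrite fE andbT; apply: yx => //.
    (* The edge [uv] may land on [e] in either orientation, so either [(u, v)] or [(v, u)] is the
       offending pair. *)
    apply: contraTneq fE => ->; apply/negP => /orP[]/eqP E.
      by have := nofix (u, v); rewrite uv' /= E !eqxx.
    by have := nofix (v, u); rewrite eq_sym uv' /= E !eqxx.
  have H2 : (#|P| <= \sum_(q : H * H | q.1 != q.2) #|fix2 q|)%N.
    have cardE1 (A : pred {ffun H -> 'I_n}) : #|A| = (\sum_h A h)%N.
      by rewrite -sum1_card big_mkcond; apply: eq_bigr => h _; rewrite unfold_in;
        case: (A h).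
    rewrite (eq_bigr (fun q => \sum_h fix2 q h)%N); last by move=> q _;
      exact: cardE1.
    rewrite cardE1 exchange_big; apply: leq_sum => h _.
    rewrite /P /=; case: existsP => // -[q /andP[q1 q2]].
    by rewrite (bigD1 q)//= q2.
  apply: (leq_trans H1); apply: leq_trans (_ : #|@is_inj_hom n H x| + #|P| <= _)%N.
    by rewrite -cardUI leq_addr.
  by rewrite leq_add2l.
apply: (@leq_trans (n ^ 2 * (inj_hom_count H x +
    \sum_(q : H * H | q.1 != q.2) #|fix2 q|))); first by rewrite leq_mul2l sub orbT.
rewrite mulnDr leq_add2l big_distrr /=.
rewrite (eq_bigr (fun=> n ^ #|H|)%N); last by move=> [u v] uv;
  apply: card_ffun_fix2.
rewrite sum_nat_const leq_mul2r; apply/orP; right.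
by rewrite -[(_ ^ 2)%N]/(#|H| * #|H|)%N -card_prod max_card.
Qed.

End EdgeFlip.

Section EdgeDensity.
Variables (R : realType) (s : nat) (beta : 'I_s -> R) (G : 'I_s -> sgraph).

Definition flip_cost : R := expR (\sum_(i < s) `|beta i| * (#|G i| ^ 2)%:R).

(** The bound of [inj_hom_count_local] cancels the scaling [n^2 n^(-|V|)] exactly. One edge thus
    changes each term of the exponent by at most [|beta i| |V|^2], uniformly in [n]. *)
Lemma ergm_weight_flip (n : nat) (x y : config n) (e : edge n) :
  (forall f, x f -> y f) -> (forall f, f != e -> y f -> x f) ->
  ergm_weight beta G x <= flip_cost * ergm_weight beta G y.
Proof.
move=> xy yx.
have n0 : (0 < n)%N by case: n e {x y xy yx} => // -[[[]]].
rewrite /ergm_weight /flip_cost -expRD ler_expR -lerBlDr -mulrBr -sumrB mulr_sumr.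
apply: ler_sum => i _.
have := inj_hom_count_local (G i) yx; have := inj_hom_count_mono (G i) xy.
move: (inj_hom_count _ x) (inj_hom_count _ y) => N0 N1 le01 bound.
have np : 0 < n%:R ^+ #|G i| :> R by rewrite exprn_gt0// ltr0n.
(* The natural subtraction is exact, since [N0 <= N1] by monotonicity. *)
pose c : R := n%:R ^+ 2 * n%:R ^- #|G i| * (N1 - N0)%:R.
have c0 : 0 <= c by rewrite !mulr_ge0// ?invr_ge0 ?exprn_ge0.
have c1 : c <= (#|G i| ^ 2)%:R.
  rewrite /c mulrAC ler_pdivrMr// -!natrX -!natrM ler_nat.
  by rewrite mulnBr leq_subLR.
have -> : n%:R ^+ 2 * (beta i * n%:R ^- #|G i| * N0%:R - beta i * n%:R ^- #|G i|
  * N1%:R)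
    = - beta i * c by rewrite /c natrB//; ring.
apply: (@le_trans _ _ (`|beta i| * c)); last by rewrite ler_wpM2l.
by rewrite ler_wpM2r// -normrN ler_norm.
Qed.

Lemma ergm_flip_le (n : nat) (x : config n) (e : edge n) :
  ergm beta G n (upd x e false) <= flip_cost * ergm beta G n (upd x e true).
Proof.
rewrite -[leLHS]/(_ * ergm_weight beta G (upd x e false)).
rewrite -[X in _ <= _ * X]/(_ * ergm_weight beta G (upd x e true)).
rewrite [leRHS]mulrCA; apply: ler_wpM2l; first by rewrite invr_ge0 ltW ?ergm_Z_gt0.
apply: (@ergm_weight_flip n (upd x e false) (upd x e true) e) => f.
  exact: upd_mono.
exact: upd_off.
Qed.

(** Starting from the constant 1, the edges [f] and then [e] are forced to be present, each at the
    price of a factor [1 + flip_cost]. *)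
Lemma mu2_ge (n : nat) (e f : edge n) : e != f -> share_vertex e f ->
  (1 + flip_cost) ^- 2 <= mu2 beta G n.
Proof.
move=> ef sh; rewrite (mu2E _ _ ef sh).
have c0 : 0 < flip_cost by exact: expR_gt0.
have step (i : edge n) (g : config n -> R) : (forall x, 0 <= g x) ->
    (forall x y, g (upd x i y) = g x) ->
    expect (ergm beta G n) g <= (1 + flip_cost) * expect (ergm beta G n) (fun x
      => (x i)%:R * g x).
  by apply: expect_coord_ge => x; exact: ergm_flip_le.
have h1 := step f (fun=> 1) (fun=> ler01) (fun _ _ => erefl).
have h2 := step e (fun x => (x f)%:R) (fun=> ler0n _ _).
rewrite -[leLHS]mul1r ler_pdivrMr ?exprn_gt0 ?addr_gt0//.
rewrite expect_cst in h1; rewrite mulrC expr2 -mulrA.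
apply: le_trans h1 _; rewrite ler_pM2l ?addr_gt0//.
rewrite (@eq_expect _ _ _ _ (fun x : config n => (x f)%:R)); last by move=> x;
  rewrite mulr1.
by apply: h2 => x y; rewrite updE eq_sym (negbTE ef).
Qed.
End EdgeDensity.

(** * Variance of the triangle count *)

(** Reads the discrete derivative off as the coefficient of coordinate [i] along a fibre. *)
Lemma flip_diff_affine (R : realType) (I : finType) (g : {ffun I -> bool} -> R)
    (i : I) (x : {ffun I -> bool}) (A B : R) :
  (forall y : {ffun I -> bool}, (forall j, j != i -> y j = x j) ->
    g y = (y i)%:R * A + B) ->
  flip_diff g i x = A.
Proof.
move=> h; rewrite /flip_diff !h; last 2 first.
- by move=> j ji; rewrite updE (negbTE ji).
- by move=> j ji; rewrite updE (negbTE ji).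
by rewrite !updE eqxx /=; ring.
Qed.

Section Codegree.
Import mathcomp.boot.finset.
Local Open Scope set_scope.
Variables (R : realType) (n : nat).
Implicit Types (e f : edge n) (t : {set edge n}) (x y : config n).

(** The number of common neighbours in [x] of the endpoints of [e], written as the coefficient of
    [x e] in [T3]. *)
Definition codegree e x : R :=
  \sum_(t in triangles n | e \in t) \prod_(f in t :\ e) (x f)%:R.

Lemma prod_edge_split t e x y : (forall f, f != e -> y f = x f) -> e \in t ->
  \prod_(f in t) (y f)%:R = (y e)%:R * \prod_(f in t :\ e) (x f)%:R :> R.
Proof.
move=> yx et; rewrite (big_setD1 e)//=; congr (_ * _).
by apply: eq_bigr => f; rewrite in_setD1 => /andP[fe _]; rewrite yx.
Qed.

Lemma prod_edge_off t e x y : (forall f, f != e -> y f = x f) -> e \notin t ->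
  \prod_(f in t) (y f)%:R = \prod_(f in t) (x f)%:R :> R.
Proof.
move=> yx et; apply: eq_bigr => f ft; rewrite yx//.
by apply: contraNneq et => <-.
Qed.

(** The edge term is subtracted so that, with [c] the mean codegree, every derivative is centred. *)
Lemma flip_diff_T3 e x (c : R) :
  flip_diff (fun x => T3 R x - c * \sum_f (x f)%:R) e x = codegree e x - c.
Proof.
pose B : R := \sum_(t in triangles n | e \notin t) \prod_(f in t) (x f)%:R
   - c * \sum_(f | f != e) (x f)%:R.
apply: (@flip_diff_affine _ _ _ _ _ _ B) => y yx.
rewrite /T3 (bigID (fun t : {set edge n} => e \in t)) /= (bigD1 e) //=.
rewrite (eq_bigr (fun t => (y e)%:R * \prod_(f in t :\ e) (x f)%:R)); last first.
  by move=> t /andP[_ et]; apply: prod_edge_split.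
rewrite -mulr_sumr -/(codegree e x).
rewrite (eq_bigr (fun t => \prod_(f in t) (x f)%:R)); last first.
  by move=> t /andP[_ et]; apply: prod_edge_off et.
rewrite [X in _ - c * (_ + X)](eq_bigr (fun f => (x f)%:R)); last first.
  by move=> f fe; rewrite yx.
by rewrite /B; ring.
Qed.

Lemma flip_diff_codegree_same e x : flip_diff (codegree e) e x = 0.
Proof.
apply: (@flip_diff_affine _ _ _ _ _ _ (codegree e x)) => y yx.
rewrite mulr0 add0r; apply: eq_bigr => t _.
by apply: prod_edge_off yx _; rewrite setD11.
Qed.

Definition triangle_count2 e f : nat :=
  #|[set t in triangles n | (e \in t) && (f \in t)]|.

(** The derivative lies between 0 and the number of triangles containing both edges. That number is
    at most 1 by [triangle_uniq], so squaring does not increase the derivative. *)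
Lemma flip_diff_codegree_sq e f x : f != e ->
  flip_diff (codegree e) f x ^+ 2 <= (triangle_count2 e f)%:R.
Proof.
move=> fe.
pose D : R := \sum_(t in triangles n | (e \in t) && (f \in t))
   \prod_(g in t :\ e :\ f) (x g)%:R.
have -> : flip_diff (codegree e) f x = D.
  pose B : R := \sum_(t in triangles n | (e \in t) && (f \notin t))
     \prod_(g in t :\ e) (x g)%:R.
  apply: (@flip_diff_affine _ _ _ _ _ _ B) => y yx.
  rewrite /codegree (bigID (fun t : {set edge n} => f \in t)) /=.
  rewrite /D mulr_sumr; congr (_ + _).
    apply: eq_big => [t|t /andP[_ ft]]; first by rewrite andbA.
    by apply: prod_edge_split; rewrite // in_setD1 fe.
  apply: eq_big => [t|t /andP[_ ft]]; first by rewrite andbA.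
  by apply: prod_edge_off yx _; rewrite in_setD1 fe.
have p01 t : 0 <= \prod_(g in t :\ e :\ f) ((x g)%:R : R) <= 1.
  rewrite prodr_ge0//=; apply: prodr_ile1 => g _.
  by rewrite ler0n lern1; case: (x g).
have D0 : 0 <= D by apply: sumr_ge0 => t _; case/andP: (p01 t).
have DC : D <= (triangle_count2 e f)%:R.
  rewrite /triangle_count2 -sum1_card natr_sum.
  rewrite (eq_bigl (fun t => (t \in triangles n) && ((e \in t) && (f \in t))));
    last first.
    by move=> t; rewrite in_set.
  by apply: ler_sum => t _; case/andP: (p01 t).
have C1 : (triangle_count2 e f <= 1)%N.
  apply/card_le1_eqP => t t'; rewrite in_set => /and3P[tT et ft].
  rewrite in_set => /and3P[tT' et' ft'].
  exact: (triangle_uniq fe tT' tT ft' et' ft et).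
apply: (le_trans _ DC); rewrite expr2 ler_piMr//.
by apply: (le_trans DC); rewrite lern1.
Qed.

(** Double counting: each of the [n - 2] triangles through [e] has two further edges. *)
Lemma sum_triangle_count2 e :
  (\sum_(f | f != e) triangle_count2 e f = 2 * (n - 2))%N.
Proof.
under eq_bigr do rewrite /triangle_count2 -sum1dep_card big_mkcond /=.
rewrite exchange_big /=.
rewrite -(card_triangles_edge e) mulnC -sum1dep_card big_distrl [RHS]big_mkcond /=.
apply: eq_bigr => t _.
case: (boolP (t \in _)) => /= [tT|_]; last by rewrite big1.
case: (boolP (e \in t)) => /= [et|_]; last by rewrite big1.
rewrite -big_mkcondr /= sum1dep_card.
have <- : #|t :\ e| = (1 * 2)%N by have := card_triangle tT;
  rewrite (cardsD1 e) et; lia.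
by apply: eq_card => f; rewrite in_setD1 in_set.
Qed.

Lemma variance_codegree (mu : fdist R (config n)) (sigma2 : R) e :
  0 <= sigma2 -> d_LSI mu sigma2 ->
  variance mu (codegree e) <= sigma2 * (2 * (n - 2))%:R.
Proof.
move=> s0 lsi; apply: le_trans (poincare_flip (codegree e) s0 lsi) _.
apply: ler_wpM2l => //; rewrite -(sum_triangle_count2 e) natr_sum (bigD1 e) //=.
rewrite -[leRHS]add0r; apply: lerD.
  rewrite -[leRHS](expect_cst mu); apply: ler_expect => x.
  by rewrite flip_diff_codegree_same expr0n.
apply: ler_sum => f fe; rewrite -[leRHS](expect_cst mu).
by apply: ler_expect => x; apply: flip_diff_codegree_sq.
Qed.

(** Since [c] is the mean codegree, the second moment of each derivative is the variance of a
    codegree. The Poincare inequality is thus applied twice, whence [sigma2 ^+ 2]. *)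
Lemma variance_T3_sub (mu : fdist R (config n)) (sigma2 c : R) :
  0 <= sigma2 -> d_LSI mu sigma2 ->
  (forall e, expect mu (codegree e) = c) ->
  variance mu (fun x => T3 R x - c * \sum_f (x f)%:R) <=
    sigma2 ^+ 2 * (2 * (n - 2))%:R * 'C(n, 2)%:R.
Proof.
move=> s0 lsi Ec; apply: le_trans (poincare_flip _ s0 lsi) _.
rewrite expr2 -!mulrA; apply: ler_wpM2l => //.
apply: (@le_trans _ _ (\sum_(e : edge n) (sigma2 * (2 * (n - 2))%:R))).
  apply: ler_sum => e _; apply: le_trans (variance_codegree e s0 lsi).
  by rewrite /variance Ec; apply: ler_expect => x; rewrite flip_diff_T3.
rewrite sumr_const -[leLHS]mulr_natr -!mulrA.
by rewrite ler_wpM2l// ler_wpM2l// ler_nat card_edge_le.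
Qed.

(** Every derivative equals 1. This yields the uniform second moment of the normalised edge
    count. *)
Lemma variance_edge_count (mu : fdist R (config n)) (sigma2 : R) :
  0 <= sigma2 -> d_LSI mu sigma2 ->
  variance mu (fun x => \sum_f (x f)%:R) <= sigma2 * 'C(n, 2)%:R.
Proof.
move=> s0 lsi; apply: le_trans (poincare_flip _ s0 lsi) _.
apply: ler_wpM2l => //; apply: (@le_trans _ _ (\sum_(e : edge n) 1)).
  apply: ler_sum => e _; rewrite -[leRHS](expect_cst mu); apply: ler_expect => x.
  rewrite (@flip_diff_affine _ _ _ _ _ 1 (\sum_(f | f != e) (x f)%:R)) ?expr1n//.
  move=> y yx; rewrite (bigD1 e) //= mulr1; congr (_ + _).
  by apply: eq_bigr => f fe; rewrite yx.
by rewrite sumr_const ler_nat card_edge_le.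
Qed.

End Codegree.

(** Removing [e] from a triangle leaves two adjacent edges, whose product has mean [mu2]; there are
    [n - 2] such triangles. *)
Lemma expect_codegree (R : realType) (s : nat) (beta : 'I_s -> R)
    (G : 'I_s -> sgraph) (n : nat) (e : edge n) :
  expect (ergm beta G n) (codegree R e) = (n - 2)%:R * mu2 beta G n.
Proof.
rewrite expect_sum (eq_bigr (fun=> mu2 beta G n)); last first.
  move=> t /andP[tT et].
  have /eqP/cards2P[f [g [fg tfg]]] : #|(t :\ e)%SET| = 2%N.
    by have := card_triangle tT; rewrite (cardsD1 e) et; lia.
  have sub h : h \in [set f; g]%SET -> h \in t.
    by rewrite -tfg in_setD1 => /andP[].
  have ft : f \in t by apply: sub; rewrite !inE eqxx.
  have gt : g \in t by apply: sub; rewrite !inE eqxx orbT.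
  rewrite (mu2E _ _ fg (triangle_share tT ft gt)) tfg.
  by apply: eq_expect => x; rewrite big_setU1 ?big_set1 ?inE.
by rewrite -(card_triangles_edge e) -sum1dep_card natr_sum mulr_suml;
  apply: eq_bigr => t _; rewrite mul1r.
Qed.

(** * Comparison of the two normalised statistics in L2 *)

Lemma adjacent_edges_exist (n : nat) : (3 <= n)%N ->
  exists e f : edge n, e != f /\ share_vertex e f.
Proof.
case: n => [|[|[|n]]]// _.
pose v (k : nat) : 'I_n.+3 := inord k.
have vE k : (k < 3)%N -> val (v k) = k.
  by move=> k3; rewrite /v /= inordK//; apply: leq_trans k3 _.
have vneq a b : (a < 3)%N -> (b < 3)%N -> a != b -> v a != v b.
  by move=> a3 b3; apply: contraNneq => /(congr1 val); rewrite !vE// => ->.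
have [e eE] := ends_onto (vneq 0%N 1%N isT isT isT).
have [f fE] := ends_onto (vneq 0%N 2%N isT isT isT).
exists e, f; split.
  apply: contraTneq (vneq 1%N 2%N isT isT isT) => ef.
  have : v 2%N \in ends e by rewrite ef fE !inE eqxx orbT.
  rewrite eE !inE => /orP[]/eqP E; last by rewrite -E eqxx.
  by have := vneq 2%N 0%N isT isT isT; rewrite E eqxx.
rewrite share_vertexE; apply/set0Pn; exists (v 0%N).
by rewrite eE fE !inE eqxx.
Qed.

Lemma expect_sq_scaled (R : realType) (T : finType) (mu : fdist R T) (c : R)
    (f : T -> R) :
  expect mu (fun x => (c * (f x - expect mu f)) ^+ 2) = c ^+ 2 * variance mu f.
Proof. by rewrite -expectZ; apply: eq_expect => x; rewrite exprMn. Qed.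

Lemma sqrt_inv_sq_le (R : realType) (c a : R) (N : nat) : 0 <= c ->
  a <= c * N%:R -> (Num.sqrt N%:R)^-1 ^+ 2 * a <= c.
Proof.
move=> c0 ac; rewrite exprVn sqr_sqrtr//.
(* For [N = 0] the inverse of 0 is 0, so the bound also covers [n < 2], where there are no edges. *)
case: N ac => [|N] ac; first by rewrite invr0 mul0r.
by rewrite mulrC ler_pdivrMr// ltr0n.
Qed.

(** The difference is the centred [F] divided, up to sign, by the normalisation. By
    [variance_T3_sub] its second moment is at most [2 sigma2^2 / ((n - 2) mu2^2)], and [mu2_ge]
    bounds [mu2 ^- 2] by [(1 + flip_cost)^4]. *)
Lemma triangle_approx (R : realType) (s : nat) (beta : 'I_s -> R)
    (G : 'I_s -> sgraph) (n : nat) (sigma2 : R) :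
  0 <= sigma2 -> d_LSI (ergm beta G n) sigma2 -> (3 <= n)%N ->
  expect (ergm beta G n) (fun x =>
    ((Num.sqrt ('C(n, 2)%:R : R))^-1 *
       \sum_(e : edge n) ((x e)%:R - expect (ergm beta G n) (fun y => (y e)%:R))
     - (T3 R x - expect (ergm beta G n) (@T3 R n)) /
       ((n%:R - 2) * mu2 beta G n * Num.sqrt ('C(n, 2)%:R))) ^+ 2)
  <= 8 * sigma2 ^+ 2 * (1 + flip_cost beta G) ^+ 4 * n.+1%:R^-1.
Proof.
move=> s0 lsi n3; set mu := ergm beta G n.
have [e [f [ef sh]]] := adjacent_edges_exist n3.
have k0 : 0 < 1 + flip_cost beta G by rewrite addr_gt0// expR_gt0.
have m0 : 0 < mu2 beta G n.
  by apply: lt_le_trans (mu2_ge beta G ef sh); rewrite invr_gt0 exprn_gt0.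
have n2 : (n - 2)%:R = n%:R - 2 :> R by rewrite natrB//; lia.
have n20 : 0 < n%:R - 2 :> R by rewrite -n2 ltr0n; lia.
pose c : R := (n%:R - 2) * mu2 beta G n.
have c0 : 0 < c by rewrite mulr_gt0.
have q0 : 0 < Num.sqrt ('C(n, 2)%:R : R) by rewrite sqrtr_gt0 ltr0n bin_gt0; lia.
pose F (x : config n) : R := T3 R x - c * \sum_f (x f)%:R.
have vF : variance mu F <= sigma2 ^+ 2 * (2 * (n - 2))%:R * 'C(n, 2)%:R.
  by apply: variance_T3_sub => // h; rewrite expect_codegree n2.
rewrite (@eq_expect _ _ _ _ (fun x => (- c^-1 * (Num.sqrt ('C(n, 2)%:R))^-1 *
    (F x - expect mu F)) ^+ 2)); last first.
  move=> x; congr (_ ^+ 2); rewrite sumrB -expect_sum /F expectB expectZ.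
  move: (expect _ (@T3 R n)) (expect _ _) (\sum_e _) => a b d.
  by rewrite -/c; field; rewrite !gt_eqF.
rewrite (expect_sq_scaled mu (- c^-1 * (Num.sqrt ('C(n,
  2)%:R))^-1) F) exprMn -[leLHS]mulrA.
have v2 := sqrt_inv_sq_le _ vF.
have /v2{}v2 : 0 <= sigma2 ^+ 2 * (2 * (n - 2))%:R by rewrite mulr_ge0 ?sqr_ge0.
apply: (@le_trans _ _ ((- c^-1) ^+ 2 * (sigma2 ^+ 2 * (2 * (n - 2))%:R))).
  by apply: ler_wpM2l; rewrite ?sqr_ge0.
have -> : (- c^-1) ^+ 2 * (sigma2 ^+ 2 * (2 * (n - 2))%:R) =
    sigma2 ^+ 2 * (mu2 beta G n) ^- 2 * (2 / (n%:R - 2)).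
  by rewrite natrM n2 /c; field; rewrite !gt_eqF.
have -> : 8 * sigma2 ^+ 2 * (1 + flip_cost beta G) ^+ 4 * n.+1%:R^-1 =
    sigma2 ^+ 2 * (1 + flip_cost beta G) ^+ 4 * (8 / n.+1%:R) :> R by ring.
apply: ler_pM.
- by rewrite mulr_ge0 ?sqr_ge0// invr_ge0 sqr_ge0.
- by rewrite divr_ge0 ?ltW.
- rewrite ler_wpM2l ?sqr_ge0// -(invrK ((1 + flip_cost beta G) ^+ 4)).
  rewrite lef_pV2 ?posrE ?invr_gt0 ?exprn_gt0//.
  rewrite -[4%N]/(2 * 2)%N exprM -exprVn lerXn2r ?nnegrE ?invr_ge0 ?sqr_ge0 ?(ltW
    m0)//.
  exact: mu2_ge ef sh.
(* The inequality [2 / (n - 2) <= 8 / (n + 1)] holds from [n = 3] on, with equality there; this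
   fixes the 8. *)
- rewrite ler_pdivrMr// mulrAC ler_pdivlMr ?ltr0n//.
  have n3' : 3 <= n%:R :> R by rewrite ler_nat.
  by rewrite -natr1; lra.
Qed.

Theorem corollary3p3 (R : realType) (s : nat) (s_gt0 : (0 < s)%N)
    (beta : 'I_s -> R) (G : 'I_s -> sgraph)
    (G_connected : forall i, connected_graph (G i))
    (G1_K2 : graph_iso (G (Ordinal s_gt0)) (complete_graph 2))
    (sigma v : R)
    (LSI : forall n : nat, d_LSI (ergm beta G n) (sigma ^+ 2))
    (CLT : cvg_in_distribution (ergm beta G)
       (fun n x => (Num.sqrt ('C(n, 2)%:R : R))^-1 *
          \sum_(e : edge n)
             ((x e)%:R - expect (ergm beta G n) (fun y => (y e)%:R)))
       (gaussian 0 v)) :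
  cvg_in_distribution (ergm beta G)
    (fun n x => (T3 R x - expect (ergm beta G n) (@T3 R n)) /
                ((n%:R - 2) * mu2 beta G n * Num.sqrt ('C(n, 2)%:R)))
    (gaussian 0 v).

Proof.
have s0 : 0 <= sigma ^+ 2 by exact: sqr_ge0.
apply: (cvg_in_distribution_L2 (C := sigma ^+ 2)) CLT => [n|].
  pose S (x : config n) : R := \sum_f (x f)%:R.
  pose c : R := (Num.sqrt 'C(n, 2)%:R)^-1.
  rewrite (@eq_expect _ _ _ _ (fun x =>
    (c * (S x - expect (ergm beta G n) S)) ^+ 2)).
    rewrite (expect_sq_scaled _ c S).
    by apply: sqrt_inv_sq_le => //; apply: variance_edge_count.
  by move=> x; rewrite sumrB /S expect_sum.
pose C : R := 8 * (sigma ^+ 2) ^+ 2 * (1 + flip_cost beta G) ^+ 4.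
apply: (@squeeze_cvgr _ _ _ _ (fun=> 0) (fun n => C * n.+1%:R^-1)).
(* The squeeze starts at [n = 3], the first size with two adjacent edges. *)
- exists 3%N => // n /= n3; rewrite expect_ge0 => [|x]; last exact: sqr_ge0.
  exact: triangle_approx.
- exact: cvg_cst.
- rewrite -(mulr0 C); apply: cvgMr; exact: cvg_harmonic.
Qed.
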